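(* Let $L$ be a (left) Leibniz algebra over a field $\mathbb{F}$ of characteristic zero which is complete in the following sense: the Lie algebra $L/\mathrm{Leib}(L)$ has trivial center, and for every derivation $D$ of $L$ there exists $x\in L$ such that $\mathrm{Im}(D-L_x)\subseteq \mathrm{Leib}(L)$. Let $f\colon L\times L\to L$ be a bilinear map. Then $f$ is a biderivation of $L$ if and only if there exist linear maps $\varphi,\psi\colon L\to L$, a left biderivation $p\colon L\times L\to \mathrm{Leib}(L)$ of $L$ and a right biderivation $q\colon L\times L\to\mathrm{Leib}(L)$ of $L$ such that, for all $x,y\in L$, $$f(x,y)=[\varphi(x),y]+p(x,y)=[\psi(y),x]+q(x,y).$$
   Context: A (left) Leibniz algebra over a field $\mathbb{F}$ is an $\mathbb{F}$-vector space $L$ with an $\mathbb{F}$-bilinear map $[-,-]\colon L\times L\to L$ satisfying $[x,[y,z]]=[y,[x,z]]+[[x,y],z]$ for all $x,y,z\in L$. The Leibniz kernel is $\mathrm{Leib}(L)=\mathrm{span}\langle [x,x]\mid x\in L\rangle$; it is an ideal of $L$ and $L/\mathrm{Leib}(L)$ is a Lie algebra. The center of a Leibniz algebra $M$ is $\{x\in M\mid [x,y]=[y,x]=0 \text{ for all } y\in M\}$. For $x\in L$, $L_x\colon L\to L$ is the left multiplication $L_x(y)=[x,y]$. A derivation of $L$ is a linear map $D\colon L\to L$ with $D([x,y])=[D(x),y]+[x,D(y)]$ for all $x,y\in L$. A biderivation of $L$ is an $\mathbb{F}$-bilinear map $f\colon L\times L\to L$ such that $f(x,-)$ and $f(-,x)$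 are derivations of $L$ for all $x\in L$. A map $B\colon L\times L\to L$ is a left biderivation of $L$ if, for all $x,y,z\in L$, $B(\cdot,y)$ is linear and $B(x,[y,z])=[B(x,y),z]+[y,B(x,z)]$; it is a right biderivation of $L$ if, for all $x,y,z\in L$, $B(x,\cdot)$ is linear and $B([x,y],z)=[x,B(y,z)]+[B(x,z),y]$. A left or right biderivation with values in $\mathrm{Leib}(L)$ is one whose image is contained in $\mathrm{Leib}(L)$. *)

(* Defs.v *)
From HB Require Import structures.
From mathcomp Require Import all_boot all_algebra.
From mathcomp Require Import boolp.

Set Implicit Arguments.
Unset Strict Implicit.
Unset Printing Implicit Defensive.

Import GRing.Theory.
Local Open Scope ring_scope.
Local Open Scope quotient_scope.

(* The bilinearity of the bracket is stated with the predicate underlying the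
   interface {bilinear L -> L -> L}. No dimension assumption is made. *)
HB.mixin Record Lmodule_isLeibniz (F : fieldType) L of GRing.Lmodule F L := {
  bracket : L -> L -> L;
  bracket_bilinear : bilinear_for *:%R *:%R bracket;
  bracket_leibniz : forall x y z : L,
    bracket x (bracket y z) = bracket y (bracket x z) + bracket (bracket x y) z
}.

#[short(type="leibnizType")]
HB.structure Definition Leibniz (F : fieldType) :=
  {L of GRing.Lmodule F L & Lmodule_isLeibniz F L}.

Notation "\[ x , y ]" := (bracket x y)
  (at level 0, x at level 99, y at level 99, format "\[ x ,  y ]") : ring_scope.

HB.instance Definition _ (F : fieldType) (L : leibnizType F) :=
  bilinear_isBilinear.Build F L L L *:%R *:%R (@bracket F L)
    (@bracket_bilinear F L).

Definition in_center (F : fieldType) (M : leibnizType F) (x : M) : Prop :=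
  forall y : M, \[x, y] = 0 /\ \[y, x] = 0.

Definition trivial_center (F : fieldType) (M : leibnizType F) : Prop :=
  forall x : M, in_center x -> x = 0.

Definition is_derivation (F : fieldType) (L : leibnizType F) (D : L -> L) :
    Prop :=
  linear D /\ (forall x y : L, D \[x, y] = \[D x, y] + \[x, D y]).

Definition is_biderivation (F : fieldType) (L : leibnizType F)
    (f : L -> L -> L) : Prop :=
  bilinear_for *:%R *:%R f /\
  (forall x : L, is_derivation (f x) /\ is_derivation (f^~ x)).

Definition is_left_biderivation (F : fieldType) (L : leibnizType F)
    (B : L -> L -> L) : Prop :=
  (forall y : L, linear (B^~ y)) /\
  (forall x y z : L, B x \[y, z] = \[B x y, z] + \[y, B x z]).

Definition is_right_biderivation (F : fieldType) (L : leibnizType F)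
    (B : L -> L -> L) : Prop :=
  (forall x : L, linear (B x)) /\
  (forall x y z : L, B \[x, y] z = \[x, B y z] + \[B x z, y]).

(* The Leibniz kernel: the set of finite linear combinations of squares
   \[x, x]. Membership is made boolean by classical logic so that the library
   quotient by a closed predicate applies. *)
Definition Leib (F : fieldType) (L : leibnizType F) : {pred L} :=
  fun v => `[< exists s : seq (F * L), v = \sum_(p <- s) p.1 *: \[p.2, p.2] >].
Arguments Leib {F} L.

Section LeibTheory.
Variables (F : fieldType) (L : leibnizType F).
Implicit Types x y z u v : L.

Lemma LeibP v : reflect
  (exists s : seq (F * L), v = \sum_(p <- s) p.1 *: \[p.2, p.2]) (v \in Leib L).
Proof. exact: asboolP. Qed.

Lemma Leib_submod : GRing.submod_closed (Leib L).
Proof.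
split; first by apply/LeibP; exists [::]; rewrite big_nil.
move=> a u v /LeibP[s ->] /LeibP[t ->]; apply/LeibP.
exists ([seq (a * p.1, p.2) | p <- s] ++ t).
rewrite big_cat big_map scaler_sumr; congr (_ + _).
by apply: eq_bigr => p _; rewrite scalerA.
Qed.

HB.instance Definition _ :=
  GRing.isSubmodClosed.Build F L (Leib L) Leib_submod.

Lemma Leib_sq x : \[x, x] \in Leib L.
Proof. by apply/LeibP; exists [:: (1, x)]; rewrite big_seq1 scale1r. Qed.

Lemma bracketDl x y z : \[x + y, z] = \[x, z] + \[y, z].
Proof. by have := bracket_bilinear.1 z 1 x y; rewrite /= !scale1r. Qed.

Lemma bracketDr x y z : \[x, y + z] = \[x, y] + \[x, z].
Proof. by have := bracket_bilinear.2 x 1 y z; rewrite /= !scale1r. Qed.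

Lemma bracket0l y : \[0, y] = 0 :> L.
Proof. by apply: (addrI \[0, y]); rewrite -bracketDl !addr0. Qed.

Lemma bracket0r x : \[x, 0] = 0 :> L.
Proof. by apply: (addrI \[x, 0]); rewrite -bracketDr !addr0. Qed.

Lemma bracketZl a x y : \[a *: x, y] = a *: \[x, y].
Proof.
by have := bracket_bilinear.1 y a x 0; rewrite /= bracket0l !addr0.
Qed.

Lemma bracketZr a x y : \[x, a *: y] = a *: \[x, y].
Proof.
by have := bracket_bilinear.2 x a y 0; rewrite /= bracket0r !addr0.
Qed.

Lemma bracketBl x y z : \[x - y, z] = \[x, z] - \[y, z].
Proof. by rewrite bracketDl -scaleN1r bracketZl scaleN1r. Qed.

Lemma bracketBr x y z : \[x, y - z] = \[x, y] - \[x, z].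
Proof. by rewrite bracketDr -scaleN1r bracketZr scaleN1r. Qed.

Lemma bracket_Leibl u x : u \in Leib L -> \[u, x] = 0.
Proof.
case/LeibP=> s ->; elim: s => [|p s IHs]; first by rewrite big_nil bracket0l.
rewrite big_cons bracketDl IHs addr0 bracketZl.
have := bracket_leibniz p.2 p.2 x => /eqP.
by rewrite -subr_eq0 opprD addrA subrr add0r oppr_eq0 => /eqP ->; rewrite scaler0.
Qed.

Lemma bracket_sym_Leib x y : \[x, y] + \[y, x] \in Leib L.
Proof.
have -> : \[x, y] + \[y, x] = \[x + y, x + y] - (\[x, x] + \[y, y]).
  by rewrite bracketDl !bracketDr [\[x, x] + _]addrC addrACA addrK.
by rewrite rpredB ?rpredD ?Leib_sq.
Qed.

Lemma bracket_Leibr u x : u \in Leib L -> \[x, u] \in Leib L.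
Proof.
by move=> uL; have := bracket_sym_Leib x u; rewrite (bracket_Leibl x uL) addr0.
Qed.

(* L / Leib(L): the library only provides the Z-module structure of the
   quotient; scaling and bracket descend along the projection, see pi_LeibZ and
   pi_LeibB below. *)
Definition Leib_quot : Type := {ideal_quot Leib L}.

HB.instance Definition _ := GRing.Zmodule.on Leib_quot.
HB.instance Definition _ := EqQuotient.on Leib_quot.

Lemma Leib_quotP x y : reflect (x = y %[mod Leib_quot]) (x - y \in Leib L).
Proof. by rewrite Quotient.idealrBE; apply: eqP. Qed.

Definition Leib_quot_scale (a : F) := lift_op1 Leib_quot ( *:%R a).
Definition Leib_quot_bracket := lift_op2 Leib_quot (@bracket F L).

Lemma pi_Leib_scale a : {morph \pi_Leib_quot : x / a *: x >-> Leib_quot_scale a x}.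
Proof.
move=> x; unlock Leib_quot_scale; apply/Leib_quotP.
by rewrite -scalerBr rpredZ //; apply/Leib_quotP; rewrite reprK.
Qed.

Lemma pi_LeibD : {morph \pi_Leib_quot : x y / x + y}.
Proof. by move=> x y; rewrite raddfD. Qed.

Lemma pi_Leib_bracket :
  {morph \pi_Leib_quot : x y / \[x, y] >-> Leib_quot_bracket x y}.
Proof.
move=> x y; unlock Leib_quot_bracket; apply/Leib_quotP.
rewrite -[_ - _](subrKA \[x, repr (\pi_Leib_quot y)]) -bracketBr -bracketBl.
apply: rpredD; first by apply: bracket_Leibr; apply/Leib_quotP; rewrite reprK.
by rewrite bracket_Leibl ?rpred0 //; apply/Leib_quotP; rewrite reprK.
Qed.

Lemma Leib_quot_scaleA a b (q : Leib_quot) :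
  Leib_quot_scale a (Leib_quot_scale b q) = Leib_quot_scale (a * b) q.
Proof. by elim/quotW: q => x; rewrite -!pi_Leib_scale scalerA. Qed.

Lemma Leib_quot_scale1 : left_id 1 Leib_quot_scale.
Proof. by elim/quotW=> x; rewrite -pi_Leib_scale scale1r. Qed.

Lemma Leib_quot_scaleDr : right_distributive Leib_quot_scale +%R.
Proof.
move=> a; elim/quotW=> x; elim/quotW=> y.
by rewrite -!pi_Leib_scale -!pi_LeibD -pi_Leib_scale scalerDr.
Qed.

Lemma Leib_quot_scaleDl (q : Leib_quot) :
  {morph Leib_quot_scale^~ q : a b / a + b}.
Proof.
by elim/quotW: q => x a b; rewrite -!pi_Leib_scale -pi_LeibD scalerDl.
Qed.

HB.instance Definition _ := GRing.Zmodule_isLmodule.Build F Leib_quot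
  Leib_quot_scaleA Leib_quot_scale1 Leib_quot_scaleDr Leib_quot_scaleDl.

Lemma pi_LeibZ a : {morph \pi_Leib_quot : x / a *: x}.
Proof. exact: pi_Leib_scale. Qed.

Lemma Leib_quot_bracket_bilinear : bilinear_for *:%R *:%R Leib_quot_bracket.
Proof.
split; elim/quotW=> z a; elim/quotW=> x; elim/quotW=> y /=.
  by rewrite -pi_LeibZ -pi_LeibD -!pi_Leib_bracket -pi_LeibZ -pi_LeibD
    bracketDl bracketZl.
by rewrite -pi_LeibZ -pi_LeibD -!pi_Leib_bracket -pi_LeibZ -pi_LeibD
  bracketDr bracketZr.
Qed.

Lemma Leib_quot_bracket_leibniz (p q r : Leib_quot) :
  Leib_quot_bracket p (Leib_quot_bracket q r) =
  Leib_quot_bracket q (Leib_quot_bracket p r) +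
  Leib_quot_bracket (Leib_quot_bracket p q) r.
Proof.
elim/quotW: p => x; elim/quotW: q => y; elim/quotW: r => z.
by rewrite -!pi_Leib_bracket -pi_LeibD bracket_leibniz.
Qed.

HB.instance Definition _ := Lmodule_isLeibniz.Build F Leib_quot
  Leib_quot_bracket_bilinear Leib_quot_bracket_leibniz.

Lemma pi_LeibB : {morph \pi_Leib_quot : x y / \[x, y]}.
Proof. exact: pi_Leib_bracket. Qed.

(* The bracket of the quotient is alternating, so the quotient is a Lie
   algebra. *)
Lemma Leib_quot_alt (q : Leib_quot) : \[q, q] = 0.
Proof.
elim/quotW: q => x; rewrite -pi_LeibB.
have -> : 0 = \pi_Leib_quot 0 by rewrite raddf0.
by apply/Leib_quotP; rewrite subr0 Leib_sq.
Qed.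

End LeibTheory.

Arguments Leib_quot {F} L.

Definition is_complete (F : fieldType) (L : leibnizType F) : Prop :=
  trivial_center (Leib_quot L) /\
  (forall D : L -> L, is_derivation D ->
     exists x : L, forall y : L, D y - \[x, y] \in Leib L).

(* Main.v *)
(* Modulo Leib(L), the derivations f(x, -) and f(-, y) are left multiplications
   by elements which are unique modulo Leib(L), because L / Leib(L) has trivial
   center. Choosing these elements in a fixed linear complement of Leib(L) makes
   them unique, hence linear in x and y; p and q are the remainders. *)
From HB Require Import structures.
From mathcomp Require Import all_boot all_algebra.
From mathcomp Require Import boolp classical_sets.
Require Import Defs.

Import GRing.Theory.
Local Open Scope ring_scope.

(* Zorn_bigcup also applies to the empty chain, so maximality is taken among
   linearly closed sets that may be empty. *)
Lemma submod_complement (F : fieldType) (V : lmodType F) (S : {pred V}) :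
    GRing.submod_closed S ->
  exists W : set V,
    [/\ W 0, forall a u v, W u -> W v -> W (a *: u + v),
        forall u, W u -> u \in S -> u = 0
      & forall v, exists2 w, W w & v - w \in S].
Proof.
case=> S0 SD.
pose P (A : set V) := (forall a u v, A u -> A v -> A (a *: u + v)) /\
                      (forall u, A u -> u \in S -> u = 0).
have [|A [[Alin AS] Amax]] := @Zorn_bigcup V P.
  move=> C CP Ctot; split=> [a u v [X CX Xu] [Y CY Yv]|u [X CX Xu]].
    by case: (Ctot X Y CX CY) => sub; [exists Y|exists X] => //;
      apply: (CP _ _).1 => //; apply: sub.
  exact: (CP X CX).2.
(* A linearly closed set with an element [u] contains [- u + u = 0]; so if [0] were missing, [A]
   would be empty and [[set 0]] would be larger. *)
have A0 : A 0.
  apply: contrapT => nA0; apply: (Amax (A `|` [set 0])%classic).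
    by split=> [x|sub]; [left|apply: nA0; apply: sub; right].
  have noA u : ~ A u.
    by move=> Au; apply: nA0; rewrite -(addNr u) -scaleN1r; apply: Alin.
  by split=> [a u v [/noA//|->] [/noA//|->]|u [/noA//|->]//]; right;
    rewrite scaler0 addr0.
exists A; split=> // v; apply: contrapT => nv.
(* If [v] is not in [A + S], the span of [v] and [A] is strictly larger than [A] and still meets [S]
   trivially. *)
pose B : set V := fun u => exists a w, A w /\ u = a *: v + w.
apply: (Amax B).
  split=> [u Au|sub]; first by exists 0, u; rewrite scale0r add0r.
  apply: nv; exists v; last by rewrite subrr.
  by apply: sub; exists 1, 0; rewrite scale1r addr0.
split=> [c _ _ [a [w [Aw ->]]] [b [t [At ->]]]|_ [a [w [Aw ->]]] avwS].
  exists (c * a + b), (c *: w + t); split; first exact: Alin.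
  by rewrite scalerDr scalerDl scalerA addrACA.
have [a0|a0] := eqVneq a 0.
  by move: avwS; rewrite a0 scale0r add0r; apply: AS.
(* Dividing [a *: v + w] in [S] by [a] decomposes [v] along [A] and [S]. *)
case: nv; exists (- a^-1 *: w); first by rewrite -[_ *: w]addr0; apply: Alin.
rewrite scaleNr opprK.
have -> : v + a^-1 *: w = a^-1 *: (a *: v + w) + 0.
  by rewrite addr0 scalerDr scalerA mulVf // scale1r.
exact: SD.
Qed.

(** One-sided vanishing suffices for the class of [u] to be central, since the bracket is
    antisymmetric modulo [Leib L]. *)
Lemma centralizer_mod_Leib (F : fieldType) (L : leibnizType F) (u : L) :
    trivial_center (Leib_quot L) ->
  (forall y, \[u, y] \in Leib L) -> u \in Leib L.
Proof.
move=> Z uL; rewrite -[u]subr0; apply/Leib_quotP; rewrite raddf0.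
apply: Z; elim/quotW=> y; rewrite -!pi_LeibB
  -(raddf0 (\pi_(Leib_quot L)%qT : L -> _)).
split; apply/Leib_quotP; rewrite subr0 //.
by rewrite -(addrK \[u, y] \[y, u]) rpredB // bracket_sym_Leib.
Qed.

(** Stated for a general [g] so as to serve both [f] and [f] with its arguments exchanged. *)
Lemma derivation_family_lift (F : fieldType) (L : leibnizType F)
    (g : {bilinear L -> L -> L}) :
    is_complete L -> (forall x, is_derivation (g x)) ->
  exists phi : {linear L -> L}, forall x y, g x y - \[phi x, y] \in Leib L.
Proof.
move=> [Z inner] gD.
have [W [W0 Wlin WL LW]] := submod_complement _ _ _ (Leib_submod L).
have ex x : exists u, W u /\ forall y, g x y - \[u, y] \in Leib L.
  (* Replacing [u] by its component [w] in [W] is harmless: [u - w] lies in [Leib L], which acts by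
     zero from the left. *)
  have [u uP] := inner _ (gD x).
  have [w Ww uwL] := LW u; exists w; split=> // y.
  have /eqP := bracket_Leibl y uwL; rewrite bracketBl subr_eq0 => /eqP <-.
  exact: uP.
have [phi phiP] := choice ex.
have phi_linear : linear phi.
  (* The defect of linearity lies in [W], and also in [Leib L] because its brackets are combinations
     of remainders; hence it is zero. *)
  move=> a x y; apply/eqP; rewrite -subr_eq0; apply/eqP.
  apply: WL.
    rewrite [_ - _]addrC -scaleN1r; apply: (Wlin); last exact: (phiP _).1.
    by apply: Wlin; apply: (phiP _).1.
  apply: centralizer_mod_Leib => // z.
  have -> : \[phi (a *: x + y) - (a *: phi x + phi y), z] =
      a *: (g x z - \[phi x, z]) + (g y z - \[phi y, z])
        - (g (a *: x + y) z - \[phi (a *: x + y), z]).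
    rewrite bracketBl bracketDl bracketZl linearPl scalerBr addrACA opprB.
    by rewrite -opprD [RHS]addrC subrKA.
  apply: rpredB; last exact: (phiP _).2.
  by apply: rpredD; [apply: rpredZ|]; apply: (phiP _).2.
pose phiL := GRing.isLinear.Build F L L *:%R phi phi_linear.
pose phi' : {linear L -> L} := HB.pack phi phiL.
by exists phi' => x y; apply: (phiP x).2.
Qed.

(** By the Leibniz identity, left multiplication by [u] is itself a derivation. *)
Lemma left_mul_sub_derivation (F : fieldType) (L : leibnizType F)
    (D : L -> L) (u y z : L) :
    is_derivation D ->
  D \[y, z] - \[u, \[y, z]] =
    \[D y - \[u, y], z] + \[y, D z - \[u, z]].
Proof.
move=> [_ ->]; rewrite bracket_leibniz bracketBl bracketBr.
by rewrite [\[y, \[u, z]] + _]addrC opprD addrACA.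
Qed.

Theorem theorem3p1 (F : fieldType) (charF0 : [pchar F] =i pred0)
    (L : leibnizType F) (Lcomplete : is_complete L)
    (f : {bilinear L -> L -> L}) :
  is_biderivation f <->
  exists (phi psi : {linear L -> L}) (p q : L -> L -> L),
    [/\ is_left_biderivation p, (forall x y : L, p x y \in Leib L),
        is_right_biderivation q, (forall x y : L, q x y \in Leib L)
      & forall x y : L, f x y = \[phi x, y] + p x y /\
                        f x y = \[psi y, x] + q x y].
Proof.
have fl y : linear (f^~ y) by move=> a u v /=; rewrite linearPl.
have fr x : linear (f x) by move=> a u v; rewrite linearPr.
split=> [[_ fD]|[phi [psi [p [q [[_ pD] _ [_ qD] _ fE]]]]]]; last first.
  split; first by split=> [y|x] a u v /=; [apply: fl|apply: fr].
  move=> x; split; split=> // y z /=.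
    (* Each partial map of [f] is a left multiplication plus a partial map of [p] or [q], and both
       summands satisfy the product rule. *)
    rewrite !(fE _ _).1 pD bracket_leibniz bracketDl bracketDr.
    by rewrite [X in X + _ = _]addrC addrACA.
  rewrite !(fE _ _).2 qD bracket_leibniz bracketDl bracketDr.
  by rewrite addrACA [RHS]addrC.
pose g : L -> L -> L := fun x y => f y x.
have g_bilinear : bilinear_for *:%R *:%R g.
  by split=> [y|x] a u v; [apply: fr|apply: fl].
pose gB := bilinear_isBilinear.Build F L L L *:%R *:%R g g_bilinear.
pose g' : {bilinear L -> L -> L} := HB.pack g gB.
have [phi phiP] := derivation_family_lift _ _ f Lcomplete (fun x => (fD x).1).
have [psi psiP] := derivation_family_lift _ _ g' Lcomplete (fun x => (fD x).2).
exists phi, psi, (fun x y => f x y - \[phi x, y]),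
  (fun x y => f x y - \[psi y, x]).
split=> //; last by move=> x y; split; rewrite addrC subrK.
- split=> [y a u v|x y z]; last exact: left_mul_sub_derivation (fD x).1.
  by rewrite /= linearPl linearP bracketDl bracketZl scalerBr opprD addrACA.
- split=> [x a u v|x y z].
    by rewrite /= linearPr linearP bracketDl bracketZl scalerBr opprD addrACA.
  (* The rule for right biderivations is the product rule with its two summands exchanged. *)
  rewrite [RHS]addrC.
  exact: (left_mul_sub_derivation _ _ _ (psi z) x y (fD z).2).
- by move=> x y; apply: psiP.
Qed.
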